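(* Let $G$ be a connected graph with $n$ vertices. Then $$MSD^{3/2}(G)\ \ge\ 2(n-1)\,MS^{1}(G)-MS^{3/2}(G),$$ with equality if and only if $\mathrm{diam}(G)\le 2$.
   Context: All graphs are finite and simple. $d(u)$ is the degree of a vertex $u$; $d(u,v)$ is the graph distance; the transmission of $v$ is $\sigma(v)=\sum_{u\in V(G)}d(v,u)$; $\mathrm{diam}(G)$ is the maximum distance between two vertices. For real $\lambda$, $$MSD^{\lambda}(G)=\sum_{u\in V(G)}d(u)\sigma(u)^{2\lambda-1},\qquad MS^{\lambda}(G)=\sum_{u\in V(G)}\sigma(u)^{2\lambda}.$$ (The superscripts are parameters, not powers; thus $MSD^{3/2}(G)=\sum_u d(u)\sigma(u)^2$, $MS^1(G)=\sum_u\sigma(u)^2$, $MS^{3/2}(G)=\sum_u\sigma(u)^3$.) *)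

(* Defs.v *)
From mathcomp Require Import all_boot all_order all_algebra.
From mathcomp Require Import reals exp.

Set Implicit Arguments.
Unset Strict Implicit.
Unset Printing Implicit Defensive.

Import Order.TTheory GRing.Theory Num.Theory.
Local Open Scope ring_scope.

(* A finite simple graph is a symmetric irreflexive relation on a finType of
   vertices; these two hypotheses are not needed for the definitions below. *)
Section Graph.
Context {T : finType}.
Implicit Types (e : rel T) (u v : T).

Definition graph_connected e : Prop := forall u v, connect e u v.

Definition degree e u : nat := #|[set v | e u v]|.

Definition has_walk e u v (k : nat) : bool :=
  [exists p : k.-tuple T, path e u p && (last u p == v)].

(* The least length of a walk from u to v. Lengths below #|T| suffice (see
   [distP] and [dist_min]); the value is #|T| when v is unreachable from u. *)
Definition dist e u v : nat := find (has_walk e u v) (iota 0 #|T|).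

Definition transmission e v : nat := (\sum_(u : T) dist e v u)%N.

Definition diam e : nat := (\max_(u : T) \max_(v : T) dist e u v)%N.

Lemma has_walkP e u v k :
  reflect (exists p : seq T, [/\ path e u p, last u p = v & size p = k])
          (has_walk e u v k).
Proof.
apply: (iffP existsP) => [[p /andP[ep /eqP lp]]|[p [ep lp /eqP sp]]].
  by exists p; rewrite size_tuple.
by exists (Tuple sp); rewrite ep lp eqxx.
Qed.

Lemma distP e u v : connect e u v -> has_walk e u v (dist e u v).
Proof.
case/connectP=> p ep lp; case/shortenP: ep lp => q eq Uq _ lq.
have ltq : (size q < #|T|)%N by move/card_uniqP: Uq => /= <-; exact: max_card.
have hs : has (has_walk e u v) (iota 0 #|T|).
  apply/hasP; exists (size q); first by rewrite mem_iota.
  by apply/has_walkP; exists q.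
have := nth_find 0 hs; rewrite nth_iota ?add0n //.
by rewrite -[X in (_ < X)%N](size_iota 0) -has_find.
Qed.

Lemma dist_min e u v k : has_walk e u v k -> (dist e u v <= k)%N.
Proof.
move=> wk; rewrite leqNgt; apply/negP => ltk.
have ltT : (k < #|T|)%N.
  by apply: leq_trans ltk _; rewrite -[X in (_ <= X)%N](size_iota 0) find_size.
by have := before_find 0 ltk; rewrite nth_iota // add0n wk.
Qed.

End Graph.

(* The base 0 occurs only when the connected graph has a single vertex; then
   powR 0 x is 0 for x != 0 and 1 for x = 0. *)
Definition MSD (R : realType) (T : finType) (e : rel T) (lambda : R) : R :=
  \sum_(u : T) (degree e u)%:R * powR (transmission e u)%:R (2 * lambda - 1).

Definition MS (R : realType) (T : finType) (e : rel T) (lambda : R) : R :=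
  \sum_(u : T) powR (transmission e u)%:R (2 * lambda).

(* Main.v *)
Require Import Defs.
From mathcomp Require Import all_boot all_order all_algebra.
From mathcomp Require Import reals exp.
From mathcomp Require Import ring.
Import Order.TTheory GRing.Theory Num.Theory.
Local Open Scope ring_scope.

(** Fix a vertex [u]. Every other vertex is either a neighbour, which adds
    [1] to the degree and [1] to the transmission, or lies at distance at
    least [2]. So each of the [n - 1] other vertices contributes at least [2]
    to d(u) + σ(u), and a vertex at distance k > 2 contributes the surplus
    k - 2. Writing [excess u] for the total surplus, this gives the exact
    identity d(u) + σ(u) = 2 (n - 1) + excess(u) ([transmission_degree]).

    Multiplying by σ(u)^2 and summing over [u] turns the inequality into an
    identity: the two sides differ by the natural number
    Σ_u σ(u)^2 excess(u) ([MSD_MS_defect]). It vanishes exactly when every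
    [u] has σ(u) = 0 or excess(u) = 0. The first case implies the second,
    since σ(u) = 0 puts every vertex at distance 0 from [u]; and all excesses
    vanish exactly when no distance exceeds 2 ([defect_eq0]). *)

Section Distance.
Context {T : finType} {e : rel T} (e_conn : graph_connected e).
Implicit Types u v : T.

Lemma dist_eq0 u v : (dist e u v == 0%N) = (u == v).
Proof.
apply/eqP/eqP => [d0|<-].
  have := distP (e_conn u v); rewrite d0.
  by case/has_walkP=> p [_ <- /size0nil ->].
apply/eqP; rewrite -leqn0; apply: dist_min.
by apply/has_walkP; exists [::].
Qed.

Lemma dist_eq1 (e_irr : irreflexive e) u v : (dist e u v == 1%N) = e u v.
Proof.
apply/eqP/idP => [d1|euv].
  have := distP (e_conn u v); rewrite d1.
  case/has_walkP=> p [ep lp sp]; case: p ep lp sp => [|w []] //=.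
  by rewrite andbT => euw <-.
have d_le1 : (dist e u v <= 1)%N.
  by apply: dist_min; apply/has_walkP; exists [:: v]; rewrite /= euv.
have : dist e u v != 0%N.
  by rewrite dist_eq0; apply: contraTneq euv => ->; rewrite e_irr.
by case: (dist e u v) d_le1 => [|[]].
Qed.

End Distance.

Section Defect.
Context {T : finType}.
Implicit Types (e : rel T) (u v : T).

(** The subtraction is truncated, so only distances above [2] contribute. *)
Definition excess e u : nat := (\sum_v (dist e u v - 2))%N.

Definition defect e : nat :=
  (\sum_u transmission e u ^ 2 * excess e u)%N.

Lemma transmission_degree e u :
    graph_connected e -> irreflexive e ->
  (transmission e u + degree e u = 2 * #|T|.-1 + excess e u)%N.
Proof.
move=> e_conn e_irr.
have -> : degree e u = (\sum_v e u v)%N.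
  by rewrite /degree cardsE -sum1_card big_mkcond.
have -> : (2 * #|T|.-1 = \sum_v 2 * (v != u))%N.
  rewrite -big_distrr /= -(cardC1 u) -sum1_card big_mkcond /=.
  by congr (2 * _)%N; apply: eq_bigr => v _; rewrite !inE; case: eqP.
(* The identity holds vertex by vertex: the cases are distance 0, distance 1
   and distance at least 2. *)
rewrite /transmission /excess -!big_split /=; apply: eq_bigr => v _.
rewrite -(dist_eq1 e_conn e_irr) [v == u]eq_sym -(dist_eq0 e_conn).
case: (dist e u v) => [|[|k]] //=.
by rewrite addn0 muln1 subn2.
Qed.

Lemma diam_le e k :
  reflect (forall u v, dist e u v <= k)%N (diam e <= k)%N.
Proof.
rewrite /diam; apply: (iffP (bigmax_leqP _ _ _)) => [diam_k u v|dist_k u _].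
  by have /bigmax_leqP := diam_k u isT; apply.
by apply/bigmax_leqP => v _.
Qed.

Lemma excess_eq0 e u : (excess e u == 0%N) = [forall v, dist e u v <= 2]%N.
Proof. by rewrite /excess sum_nat_eq0; apply: eq_forallb => v. Qed.

Lemma defect_eq0 e : (defect e == 0%N) = (diam e <= 2)%N.
Proof.
rewrite /defect sum_nat_eq0; apply/forallP/diam_le => [defect0 u v|diam2 u].
  have := defect0 u; rewrite /= muln_eq0 expn_eq0 andbT excess_eq0.
  case/orP => [|/forallP //].
  by rewrite sum_nat_eq0 => /forallP/(_ v)/= /eqP ->.
rewrite /= muln_eq0 excess_eq0; apply/orP; right; apply/forallP => v.
exact: diam2.
Qed.

End Defect.

Lemma MSD_MS_defect (R : realType) (T : finType) (e : rel T) :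
    graph_connected e -> irreflexive e ->
  MSD e (3 / 2 : R) =
    2 * (#|T|%:R - 1) * MS e (1 : R) - MS e (3 / 2 : R) + (defect e)%:R.
Proof.
move=> e_conn e_irr.
(* All three exponents are natural numbers, so [powR] becomes [^+] below. *)
have exp_MSD : 2 * (3 / 2) - 1 = 2%:R :> R by field.
have exp_MS1 : 2 * 1 = 2%:R :> R by field.
have exp_MS : 2 * (3 / 2) = 3%:R :> R by field.
rewrite /MSD /MS exp_MSD exp_MS1 exp_MS /defect natr_sum mulr_sumr -sumrB.
rewrite -big_split /=; apply: eq_bigr => u _.
rewrite !powR_mulrn ?ler0n // natrM natrX.
(* [u] itself witnesses that T is nonempty, so the predecessor is exact. *)
have T_pred : #|T|%:R = #|T|.-1%:R + 1 :> R.
  by rewrite natr1 prednK //; apply/card_gt0P; exists u.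
have degree_eq : (transmission e u)%:R + (degree e u)%:R =
    2 * #|T|.-1%:R + (excess e u)%:R :> R.
  by rewrite -natrD transmission_degree // natrD natrM.
have -> : (degree e u)%:R =
    2 * #|T|.-1%:R + (excess e u)%:R - (transmission e u)%:R :> R.
  by rewrite -degree_eq; ring.
by rewrite T_pred; ring.
Qed.

Theorem proposition1 (R : realType) (T : finType) (e : rel T) (n : nat)
    (e_sym : symmetric e) (e_irr : irreflexive e)
    (e_conn : graph_connected e) (cardT : #|T| = n) :
  MSD e (3 / 2 : R) >= 2 * (n%:R - 1) * MS e (1 : R) - MS e (3 / 2 : R) /\
  (MSD e (3 / 2 : R) = 2 * (n%:R - 1) * MS e (1 : R) - MS e (3 / 2 : R)
     <-> (diam e <= 2)%N).
Proof.
rewrite -cardT MSD_MS_defect //; split; first by rewrite lerDl ler0n.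
rewrite -defect_eq0 -(pnatr_eq0 R) -[X in _ = X]addr0.
by split => [/addrI/eqP //|/eqP ->].
Qed.
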